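(* For no fixed positive integers $k$ and $m$ is the permanent family $(\mathrm{PER}_n)_n$ in the class $\mathrm{mSPS}(k,m)$. That is, there do not exist a polynomial $Q$ and, for each $n$, polynomials $f_{1n},\dots,f_{mn}$ in the $n^2$ variables $X_{ab}$ and non-negative integers $\alpha_{ij}$ ($1\le i\le k$, $1\le j\le m$) such that for all $n$: (i) $\mathrm{PER}_n$ depends on at most $Q(n)$ variables; (ii) $\mathrm{PER}_n(\vec X)=\sum_{i=1}^k\prod_{j=1}^m f_{jn}^{\alpha_{ij}}(\vec X)$; (iii) the bitsize of each $\alpha_{ij}$ is at most $Q(n)$; (iv) each $f_{jn}$ is computed by a constant-free arithmetic circuit of size at most $Q(n)$ and is $Q(n)$-sparse.
   Context: The permanent over $n^2$ variables is $\mathrm{PER}_n=\sum_{\sigma\in\Sigma_n}\prod_{i=1}^n X_{i\sigma(i)}$, where $\Sigma_n$ is the set of permutations of $\{1,\dots,n\}$. A polynomial is $s$-sparse if it has at most $s$ monomials. A constant-free arithmetic circuit is an arithmetic circuit with addition, subtraction and multiplication gates whose inputs are variables and no constants other than $-1$ (equivalently, only integer constants obtainable from it). The class $\mathrm{mSPS}(k,m)$ is the class of polynomial families $(P_n)$ for which there is a polynomial $Q$ such that conditions (i)–(iv) above hold with $P_n$ in place of $\mathrm{PER}_n$ (the exponents $\alpha_{ij}$ may depend on $n$). *)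

(* Defs.v *)
From HB Require Import structures.
From mathcomp Require Import all_boot all_order all_fingroup all_algebra.
From mathcomp Require Export mpoly.

Set Implicit Arguments.
Unset Strict Implicit.
Unset Printing Implicit Defensive.

Import Order.TTheory GRing.Theory Num.Theory.
Local Open Scope ring_scope.

(* The variable X_ab is 'X_(mxvec_index a b), where mxvec_index is the
   row-major bijection 'I_n * 'I_n -> 'I_(n * n). *)
Definition PER (n : nat) : {mpoly int[n * n]} :=
  \sum_(s : 'S_n) \prod_(i < n) 'X_(mxvec_index i (s i)).

Section Polynomials.
Variable v : nat.

Definition vars (p : {mpoly int[v]}) : {set 'I_v} :=
  [set i | has (fun mon : 'X_{1..v} => mon i != 0%N) (msupp p)].

Definition sparse (s : int) (p : {mpoly int[v]}) : Prop :=
  (size (msupp p))%:Z <= s.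

(* A circuit is listed in topological order: the operands of an arithmetic
   gate are the positions in the list of earlier gates, so that gates can be
   reused (unbounded fan-out). *)
Inductive gate : Type :=
| Input of 'I_v
| MinusOne
| Add of nat & nat
| Sub of nat & nat
| Mul of nat & nat.

Definition circuit := seq gate.

Definition gate_wf (pos : nat) (g : gate) : bool :=
  match g with
  | Input _ | MinusOne => true
  | Add a b | Sub a b | Mul a b => (a < pos)%N && (b < pos)%N
  end.

Definition circuit_wf (c : circuit) : Prop :=
  forall pos : nat, (pos < size c)%N -> gate_wf pos (nth MinusOne c pos).

Definition gate_val (vals : seq {mpoly int[v]}) (g : gate) : {mpoly int[v]} :=
  match g with
  | Input i => 'X_i
  | MinusOne => -1
  | Add a b => vals`_a + vals`_b
  | Sub a b => vals`_a - vals`_b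
  | Mul a b => vals`_a * vals`_b
  end.

Definition circuit_vals (c : circuit) : seq {mpoly int[v]} :=
  foldl (fun vals g => rcons vals (gate_val vals g)) [::] c.

(* Any gate may serve as the output gate. *)
Definition computes (c : circuit) (p : {mpoly int[v]}) : Prop :=
  circuit_wf c /\
  exists2 out : nat, (out < size c)%N & (circuit_vals c)`_out = p.

(* The size of a circuit is its number of gates, inputs included. *)
Definition circuit_size (c : circuit) : nat := size c.

End Polynomials.

(* Number of binary digits; 0 has one digit. *)
Definition bitsize (a : nat) : nat := (trunc_log 2 a).+1.

Definition mSPS (k m : nat) (v : nat -> nat)
    (P : forall n : nat, {mpoly int[v n]}) : Prop :=
  exists Q : {poly int}, forall n : nat, (0 < n)%N ->
  exists (f : 'I_m -> {mpoly int[v n]}) (alpha : 'I_k -> 'I_m -> nat),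
    [/\ #|vars (P n)|%:Z <= Q.[n%:Z],
        P n = \sum_(i < k) \prod_(j < m) f j ^+ alpha i j,
        forall i j, (bitsize (alpha i j))%:Z <= Q.[n%:Z]
      & forall j,
          (exists2 c : circuit (v n),
             computes c (f j) & (circuit_size c)%:Z <= Q.[n%:Z])
          /\ sparse Q.[n%:Z] (f j)].

(* Main.v *)
(* If PER_(n+1) is a polynomial in f_1, ..., f_m, then substituting 1 on and
   below the diagonal, X_i in position (i, i + 1) and 0 elsewhere shows that
   P = (1 + X_1) ... (1 + X_n) is a polynomial in m polynomials that are at
   least as sparse. By the chain rule the gradient of P lies in the row space
   of their Jacobian matrix. Let D be a nonzero minor of maximal size of that
   matrix. For a column x outside D, the minor bordered by x and by the gradient
   of P vanishes, so D dP/dX_x is a combination of the dP/dX_z with z a column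
   of D. At X_x = -1 each such dP/dX_z vanishes and dP/dX_x does not, hence D
   vanishes there. A nonzero polynomial vanishing at X_x = -1 for at least n - m
   variables X_x has at least 2^(n - m) monomials, whereas D has at most m! s^m
   of them if each f_j is s-sparse. *)
Require Import Defs.
From HB Require Import structures.
From mathcomp Require Import all_boot all_order all_fingroup all_algebra.
From mathcomp Require Import zify.

Set Implicit Arguments.
Unset Strict Implicit.
Unset Printing Implicit Defensive.

Import Order.TTheory GRing.Theory Num.Theory.

Section Sparsity.
Local Open Scope ring_scope.
Variables (n : nat) (R : nzRingType).
Implicit Types p q : {mpoly R[n]}.

Definition sparsity p : nat := size (msupp p).

Lemma sparsity_gt0 p : (0 < sparsity p)%N = (p != 0).
Proof. by rewrite lt0n size_eq0 msupp_eq0. Qed.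

Lemma sparsity0 : sparsity 0 = 0%N.
Proof. by rewrite /sparsity -mpolyC0 msupp0. Qed.

Lemma sparsity1 : sparsity 1 = 1%N.
Proof. by rewrite /sparsity -mpolyC1 msupp1. Qed.

Lemma sparsityX m : sparsity 'X_[m] = 1%N.
Proof. by rewrite /sparsity msuppX. Qed.

Lemma sparsityN p : sparsity (- p) = sparsity p.
Proof. exact: perm_size (msuppN p). Qed.

Lemma sparsityD p q : (sparsity (p + q) <= sparsity p + sparsity q)%N.
Proof.
by rewrite -size_cat; apply: uniq_leq_size (msupp_uniq _) (@msuppD_le _ _ p q).
Qed.

Lemma sparsityM p q : (sparsity (p * q) <= sparsity p * sparsity q)%N.
Proof.
rewrite -(size_allpairs (fun m1 m2 : 'X_{1..n} => (m1 + m2)%MM)).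
exact: uniq_leq_size (msupp_uniq _) (@msuppM_le _ _ p q).
Qed.

Lemma sparsityZ c p : (sparsity (c *: p) <= sparsity p)%N.
Proof. exact: uniq_leq_size (msupp_uniq _) (@msuppZ_le _ _ c p). Qed.

Lemma sparsity_sum (I : Type) (r : seq I) (P : pred I) (F : I -> {mpoly R[n]}) :
  (sparsity (\sum_(i <- r | P i) F i) <=
   \sum_(i <- r | P i) sparsity (F i))%N.
Proof.
apply: (big_ind2 (fun p k => sparsity p <= k)%N) => [|p k q l hp hq|//].
  by rewrite sparsity0.
exact: leq_trans (sparsityD p q) (leq_add hp hq).
Qed.

Lemma sparsity_prod (I : Type) (r : seq I) (P : pred I)
    (F : I -> {mpoly R[n]}) :
  (sparsity (\prod_(i <- r | P i) F i) <=
   \prod_(i <- r | P i) sparsity (F i))%N.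
Proof.
apply: (big_ind2 (fun p k => sparsity p <= k)%N) => [|p k q l hp hq|//].
  by rewrite sparsity1.
exact: leq_trans (sparsityM p q) (leq_mul hp hq).
Qed.

Lemma sparsityXn p k : (sparsity (p ^+ k) <= sparsity p ^ k)%N.
Proof.
elim: k => [|k IH]; first by rewrite expr0 sparsity1.
by rewrite exprS expnS; apply: leq_trans (sparsityM _ _) (leq_mul _ IH).
Qed.

Lemma sparsity_mderiv i p : (sparsity p^`M(i) <= sparsity p)%N.
Proof.
rewrite -[leqRHS](size_map (fun m => (m - U_(i))%MM)).
apply: uniq_leq_size (msupp_uniq _) _ => m; rewrite mcoeff_msupp mcoeff_mderiv.
move=> nz; apply/mapP; exists (m + U_(i))%MM; last by rewrite addmK.
by rewrite mcoeff_msupp; apply: contraNneq nz => ->; rewrite mul0rn.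
Qed.

Lemma sparsity_pihomog (mf : measure n) d p :
  sparsity (pihomog mf d p) = count (fun m => mf m == d) (msupp p).
Proof.
rewrite /sparsity pihomogE -big_filter (perm_size (msupp_sumX _ _)).
- exact: size_filter.
- exact/filter_uniq/msupp_uniq.
- by move=> m; rewrite mem_filter mcoeff_msupp => /andP[].
Qed.

Lemma sparsity_pihomogD (mf : measure n) d e p : d != e ->
  (sparsity (pihomog mf d p) + sparsity (pihomog mf e p) <= sparsity p)%N.
Proof.
move=> de; rewrite !sparsity_pihomog.
rewrite -[leqRHS](count_predC (fun m => mf m == d)) leq_add2l.
by apply: sub_count => m /= /eqP->; rewrite eq_sym.
Qed.

End Sparsity.

Section SparsityCom.
Local Open Scope ring_scope.
Variable R : comNzRingType.

Lemma sparsity_comp_mpoly n k (p : {mpoly R[n]}) (lq : n.-tuple {mpoly R[k]}) :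
  (forall i, sparsity (tnth lq i) <= 1)%N ->
  (sparsity (p \mPo lq) <= sparsity p)%N.
Proof.
move=> lq1; rewrite comp_mpolyE; apply: leq_trans (sparsity_sum _ _ _) _.
rewrite /sparsity -sum1_size; apply: leq_sum => m _.
apply: leq_trans (sparsityZ _ _) (leq_trans (sparsity_prod _ _ _) _).
rewrite -[leqRHS](exp1n #|'I_n|) -prod_nat_const; apply: leq_prod => i _.
apply: leq_trans (sparsityXn _ _) _.
by case: (m i) => // e; rewrite -[leqRHS](exp1n e.+1) leq_exp2r.
Qed.

Lemma sparsity_det n d B (A : 'M[{mpoly R[n]}]_d) :
  (forall i j, sparsity (A i j) <= B)%N -> (sparsity (\det A) <= d`! * B ^ d)%N.
Proof.
move=> leq_A_B; apply: leq_trans (sparsity_sum _ _ _) _.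
rewrite -card_Sn -sum_nat_const; apply: leq_sum => s _.
rewrite mulr_sign (fun_if (@sparsity n R)) sparsityN if_same.
apply: leq_trans (sparsity_prod _ _ _) _.
rewrite -[X in (_ <= _ ^ X)%N]card_ord -prod_nat_const.
exact: leq_prod.
Qed.

End SparsityCom.

Section Specialization.
Local Open Scope ring_scope.
Variables (n : nat) (R : idomainType).
Implicit Types (p : {mpoly R[n]}) (x y : 'I_n) (a : R).

Definition specialize x a : {mpoly R[n]} -> {mpoly R[n]} :=
  comp_mpoly [tuple if i == x then a%:MP else 'X_i | i < n].

HB.instance Definition _ x a := GRing.LRMorphism.on (specialize x a).

Lemma specializeXU x a i :
  specialize x a 'X_i = if i == x then a%:MP else 'X_i.
Proof. by rewrite /specialize comp_mpolyXU -tnth_nth tnth_mktuple. Qed.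

Lemma specializeX x a m :
  specialize x a 'X_[m] = a ^+ m x *: 'X_[m - U_(x) *+ m x].
Proof.
rewrite mpolyXE_id rmorph_prod (bigD1 x) //= rmorphXn /= specializeXU eqxx.
rewrite -rmorphXn mul_mpolyC; congr (_ *: _).
rewrite mpolyXE_id [RHS](bigD1 x) //= mnmBE mulmnE mnm1E eqxx mul1n subnn.
rewrite expr0 mul1r; apply: eq_bigr => i /negPf ix.
by rewrite rmorphXn /= specializeXU ix mnmBE mulmnE mnm1E eq_sym ix subn0.
Qed.

Definition degree_in x (m : 'X_{1..n}) : nat := m x.

HB.instance Definition _ x :=
  isMeasure.Build n (degree_in x) (mnm0E x) (fun m1 m2 => mnmDE x m1 m2).

Lemma specialize_pihomog x y a d p : x != y ->
  specialize y a (pihomog (degree_in x) d p) =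
  pihomog (degree_in x) d (specialize y a p).
Proof.
move=> xy; elim/mpolyind: p => [|c m p _ _ IH]; first by rewrite !linear0.
rewrite !linearD !linearZ /= IH; congr (_ *: _ + _).
have same_degree : degree_in x (m - U_(y) *+ m y)%MM = degree_in x m.
  by rewrite /degree_in mnmBE mulmnE mnm1E eq_sym (negPf xy) subn0.
rewrite specializeX linearZ /= !pihomogX /= same_degree.
by case: ifP => _; rewrite ?linear0 ?scaler0 // specializeX.
Qed.

Lemma mulX_specialize_homog x a d p : p \is d.-homog for (degree_in x) ->
  'X_x ^+ d * specialize x a p = a ^+ d *: p.
Proof.
move/dhomogP=> hp; rewrite {1}[p]mpolyE linear_sum mulr_sumr.
rewrite [in RHS](mpolyE p) scaler_sumr; apply: eq_big_seq => m /hp <- /=.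
rewrite linearZ /= specializeX -!scalerAr scalerA mulrC -scalerA /degree_in.
congr (_ *: (_ *: _)); rewrite mpolyXn -mpolyXD addmC submK //.
apply/mnm_lepP => i; rewrite mulmnE mnm1E.
by case: eqP => [->|]; rewrite ?mul1n.
Qed.

(* Splitting p by degree in one of the variables preserves the vanishing
   conditions on the others, and vanishing in that variable forces at least two
   homogeneous components to be nonzero. *)
Lemma sparsity_vanishing (a : 'I_n -> R) (r : seq 'I_n) p :
    uniq r -> p != 0 ->
    {in r, forall x, a x != 0 /\ specialize x (a x) p = 0} ->
  (2 ^ size r <= sparsity p)%N.
Proof.
elim: r p => [|x r IH] p /= => [_ nzp _|/andP[xr ur] nzp van].
  by rewrite sparsity_gt0.
have [ax0 px0] := van x (mem_head x r).
have bound_component m : m \in msupp p ->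
    (2 ^ size r <= sparsity (pihomog (degree_in x) (m x) p))%N.
  move=> mp; apply: IH => // [|y yr].
    rewrite -sparsity_gt0 sparsity_pihomog -has_count.
    by apply/hasP; exists m.
  have [ay0 py0] := van y (mem_behead (s := x :: r) yr).
  split=> //; rewrite specialize_pihomog ?py0 ?linear0 //.
  by apply: contraNneq xr => ->.
have [m mp] : exists m, m \in msupp p by exists (mlead p); apply: mlead_supp.
have [e ep em] : exists2 e, e \in msupp p & m x != e x.
  apply/hasP; apply: contraT; rewrite -all_predC => /allP same.
  have hom_p : p \is (m x).-homog for (degree_in x).
    by apply/dhomogP => e /same /=; rewrite negbK => /eqP.
  have /eqP := mulX_specialize_homog (a x) hom_p.
  rewrite px0 mulr0 -mul_mpolyC eq_sym mulf_eq0 mpolyC_eq0.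
  by rewrite expf_eq0 (negPf ax0) (negPf nzp) andbF.
rewrite expnS mul2n -addnn; apply: leq_trans (sparsity_pihomogD _ p em).
exact: leq_add (bound_component m mp) (bound_component e ep).
Qed.

End Specialization.

Lemma mderivXU (n : nat) (R : nzRingType) (i x : 'I_n) :
  (('X_i : {mpoly R[n]})^`M(x) = (i == x)%:R)%R.
Proof.
rewrite mderivX mnm1E; case: eqP => [->|_]; last by rewrite scale0r.
by rewrite scale1r -[X in (X - _)%MM]add0m addmK mpolyX0.
Qed.

Section ChainRule.
Local Open Scope ring_scope.
Variables (R : comNzRingType) (m n : nat) (lq : m.-tuple {mpoly R[n]}).

Lemma mderiv_comp_mpoly (p : {mpoly R[m]}) x :
  (p \mPo lq)^`M(x) = \sum_i (p^`M(i) \mPo lq) * (tnth lq i)^`M(x).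
Proof.
pose chain q :=
  (q \mPo lq)^`M(x) = \sum_i (q^`M(i) \mPo lq) * (tnth lq i)^`M(x).
have chainC c : chain c%:MP.
  rewrite /chain comp_mpolyC mderivC big1 // => i _.
  by rewrite mderivC comp_mpoly0 mul0r.
have chainX i : chain 'X_i.
  rewrite /chain comp_mpolyXU -tnth_nth (bigD1 i) //= mderivXU eqxx.
  rewrite comp_mpoly1 mul1r big1 ?addr0 // => j ji.
  by rewrite mderivXU eq_sym (negPf ji) comp_mpoly0 mul0r.
have chainD q r : chain q -> chain r -> chain (q + r).
  rewrite /chain comp_mpolyD mderivD => -> ->; rewrite -big_split /=.
  by apply: eq_bigr => i _; rewrite mderivD comp_mpolyD mulrDl.
have chainM q r : chain q -> chain r -> chain (q * r).
  rewrite /chain rmorphM mderivM /= => -> ->.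
  rewrite mulr_suml mulr_sumr -big_split /=; apply: eq_bigr => i _.
  by rewrite mderivM comp_mpolyD !rmorphM /= mulrDl mulrAC mulrA.
rewrite -/(chain p) [p]mpolyE; apply: (big_ind chain) => [|//|e _].
  by rewrite -mpolyC0.
rewrite -mul_mpolyC mpolyXE_id; apply: (chainM _ _ (chainC _)).
apply: (big_ind chain) => [|//|i _]; first by rewrite -mpolyC1.
by elim: (e i) => [|k IH]; rewrite ?expr0 -?mpolyC1 // exprS; apply: chainM.
Qed.

Definition gradient k (p : {mpoly R[k]}) : 'rV[{mpoly R[k]}]_k :=
  \row_x p^`M(x).

Definition jacobian : 'M[{mpoly R[n]}]_(m, n) :=
  \matrix_(i, x) (tnth lq i)^`M(x).

Lemma gradient_comp_mpoly (p : {mpoly R[m]}) :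
  gradient (p \mPo lq) = map_mx (comp_mpoly lq) (gradient p) *m jacobian.
Proof.
apply/rowP => x; rewrite !mxE mderiv_comp_mpoly.
by apply: eq_bigr => i _; rewrite !mxE.
Qed.

End ChainRule.

Lemma comp_mpolyA (R : comNzRingType) (k m n : nat) (p : {mpoly R[k]})
    (lq : k.-tuple {mpoly R[m]}) (lr : m.-tuple {mpoly R[n]}) :
  ((p \mPo lq) \mPo lr = p \mPo [tuple tnth lq i \mPo lr | i < k])%R.
Proof.
rewrite [p \mPo lq]comp_mpolyE linear_sum comp_mpolyE; apply: eq_bigr => e _ /=.
rewrite linearZ rmorph_prod /=; congr (_ *: _)%R; apply: eq_bigr => i _.
by rewrite rmorphXn tnth_mktuple.
Qed.

Lemma sum_prodX_comp_mpoly (R : comNzRingType) (k m n : nat)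
    (alpha : 'I_k -> 'I_m -> nat) (lq : m.-tuple {mpoly R[n]}) :
  ((\sum_i \prod_j 'X_j ^+ alpha i j) \mPo lq =
   \sum_i \prod_j tnth lq j ^+ alpha i j)%R.
Proof.
rewrite rmorph_sum; apply: eq_bigr => i _; rewrite rmorph_prod.
by apply: eq_bigr => j _; rewrite rmorphXn /= comp_mpolyXU -tnth_nth.
Qed.

Section Minors.
Local Open Scope ring_scope.
Variable R : comNzRingType.

Definition signed_minors d (B : 'M[R]_(d, d.+1)) : 'cV[R]_d.+1 :=
  \col_j ((-1) ^+ j * \det (col' j B)).

Lemma det_col_mx d (u : 'rV[R]_d.+1) (B : 'M[R]_(d, d.+1)) :
  \det (col_mx u B : 'M_(1 + d)) = (u *m signed_minors B) 0 0.
Proof.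
rewrite (expand_det_row _ (lshift d 0)) mxE; apply: eq_bigr => j _.
rewrite col_mxEu mxE; congr (_ * (_ * \det _)).
apply/matrixP => i l; rewrite 2![LHS]mxE [RHS]mxE.
by rewrite (_ : lift _ i = rshift 1 i) ?col_mxEd //; apply: val_inj.
Qed.

Variables (m n : nat) (J : 'M[R]_(m, n)).

Definition minor d (g : d.-tuple 'I_m) (h : d.-tuple 'I_n) : R :=
  \det (mxsub (tnth g) (tnth h) J).

Lemma minor_neq0_leq d (g : d.-tuple 'I_m) (h : d.-tuple 'I_n) :
  minor g h != 0 -> (d <= m)%N.
Proof.
apply: contraNT => dm; have : ~~ injectiveb (tnth g).
  by apply: contra dm => /injectiveP/leq_card; rewrite !card_ord.
case/injectivePn => i [j ij gij].
by apply/eqP/(determinant_alternate ij) => x; rewrite !mxE gij.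
Qed.

Lemma exists_maximal_minor :
  exists d (g : d.-tuple 'I_m) (h : d.-tuple 'I_n), minor g h != 0 /\
    forall k x, minor [tuple of k :: g] [tuple of x :: h] = 0.
Proof.
pose nonzero_minor d :=
  [exists g : d.-tuple 'I_m, exists h : d.-tuple 'I_n, minor g h != 0].
have minor0 : nonzero_minor 0.
  apply/existsP; exists [tuple]; apply/existsP; exists [tuple].
  by rewrite /minor det_mx00 oner_neq0.
have bound d : nonzero_minor d -> (d <= m)%N.
  by case/existsP=> g /existsP[h]; apply: minor_neq0_leq.
have [d /existsP[g /existsP[h nz]] dmax] :=
  ex_maxnP (ex_intro _ 0%N minor0) bound.
exists d, g, h; split=> // k x; apply: contraFeq (ltnn d) => nz_kx.
apply: dmax; apply/existsP; exists [tuple of k :: g].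
by apply/existsP; exists [tuple of x :: h].
Qed.

(* The signed minors of the rows g on the columns x :: h form a linear relation
   between these columns of J. *)
Lemma bordered_minors_eq0_relation d (g : d.-tuple 'I_m)
    (h : d.-tuple 'I_n) x :
    (forall k, minor [tuple of k :: g] [tuple of x :: h] = 0) ->
  exists e : 'I_d -> R, forall c : 'rV_m,
    (c *m J) 0 x * minor g h = \sum_j (c *m J) 0 (tnth h j) * e j.
Proof.
move=> bordered0; pose xh := tnth [tuple of x :: h].
pose v := signed_minors (mxsub (tnth g) xh J).
have Jv0 : colsub xh J *m v = 0.
  apply/colP => k.
  have -> : (colsub xh J *m v) k 0 = (row k (colsub xh J) *m v) 0 0.
    by rewrite -row_mul [RHS]mxE.
  rewrite -det_col_mx [RHS]mxE -[RHS](bordered0 k); congr (\det _).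
  apply/matrixP => i j; rewrite [RHS]mxE (tnth_nth k).
  by case: (split_ordP i) => l ->; rewrite ?col_mxEu ?col_mxEd ?ord1 !mxE //=
    -tnth_nth.
have v0 : v ord0 0 = minor g h.
  rewrite mxE expr0 mul1r; congr (\det _); apply/matrixP => i j.
  by rewrite !mxE /xh tnthS.
exists (fun j => - v (lift ord0 j) 0) => c.
have: (colsub xh (c *m J) *m v) 0 0 = 0.
  by rewrite -mulmx_colsub -mulmxA Jv0 mulmx0 mxE.
rewrite mxE big_ord_recl v0 [colsub _ _ _ _]mxE /xh tnth0.
move/eqP; rewrite addr_eq0 => /eqP->; rewrite -sumrN; apply: eq_bigr => j _.
by rewrite [colsub _ _ _ _]mxE tnthS mulrN.
Qed.

End Minors.

Section ProductLowerBound.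
Local Open Scope ring_scope.
Variables (R : idomainType) (n : nat).

Definition prod_1DX : {mpoly R[n]} := \prod_(i < n) (1 + 'X_i).

Lemma mderiv_prod_1DX x : prod_1DX^`M(x) = \prod_(i < n | i != x) (1 + 'X_i).
Proof.
have mderiv_1DX i : (1 + 'X_i : {mpoly R[n]})^`M(x) = (i == x)%:R.
  by rewrite mderivD -mpolyC1 mderivC add0r mderivXU.
have rest0 : (\prod_(i < n | i != x) (1 + 'X_i : {mpoly R[n]}))^`M(x) = 0.
  elim/big_rec: _ => [|i p /negPf ix IH]; first by rewrite -mpolyC1 mderivC.
  by rewrite mderivM IH mderiv_1DX ix mul0r mulr0 addr0.
rewrite /prod_1DX (bigD1 x) //= mderivM rest0 mderiv_1DX eqxx.
by rewrite mul1r mulr0 addr0.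
Qed.

Lemma specialize_mderiv_prod_1DX_eq0 x l :
  (specialize x (-1) prod_1DX^`M(l) == 0) = (l != x).
Proof.
have specialize_1DX i :
    specialize x (-1) (1 + 'X_i) =
    if i == x then 0 else 1 + 'X_i :> {mpoly R[n]}.
  rewrite rmorphD rmorph1 /= specializeXU.
  by case: eqP => // _; rewrite mpolyCN mpolyC1 subrr.
rewrite mderiv_prod_1DX rmorph_prod; apply/prodf_eq0/idP => [[i il]|lx] /=.
  rewrite specialize_1DX; have [<-|_] := eqVneq i x.
    by rewrite (eq_sym l).
  move/eqP/(congr1 (mcoeff 0%MM))/eqP.
  by rewrite mcoeffD mcoeff1 mcoeffX mnm1_eq0 eqxx addr0 mcoeff0 oner_eq0.
by exists x; rewrite 1?eq_sym // specialize_1DX eqxx.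
Qed.

Section Composition.
Variables (m : nat) (p : {mpoly R[m]}) (lq : m.-tuple {mpoly R[n]}).
Hypothesis prod_1DX_comp : prod_1DX = p \mPo lq.

Lemma specialize_minor_jacobian_eq0 d (g : d.-tuple 'I_m)
    (h : d.-tuple 'I_n) x :
    (forall k, minor (jacobian lq) [tuple of k :: g] [tuple of x :: h] = 0) ->
    x \notin h ->
  specialize x (-1) (minor (jacobian lq) g h) = 0.
Proof.
move=> /bordered_minors_eq0_relation[e relation] xh.
have := relation (map_mx (comp_mpoly lq) (gradient p)).
rewrite -gradient_comp_mpoly -prod_1DX_comp mxE.
move/(congr1 (specialize x (-1))).
rewrite rmorphM [RHS]rmorph_sum [RHS]big1 /= => [/eqP|j _].
  by rewrite mulf_eq0 specialize_mderiv_prod_1DX_eq0 eqxx => /eqP.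
have /eqP vanish : specialize x (-1) prod_1DX^`M(tnth h j) == 0.
  rewrite specialize_mderiv_prod_1DX_eq0.
  by apply: contraNneq xh => <-; apply: mem_tnth.
by rewrite mxE rmorphM /= vanish mul0r.
Qed.

Lemma prod_1DX_comp_sparsity_bound B :
  (0 < B)%N -> (forall j, sparsity (tnth lq j) <= B)%N ->
  (2 ^ (n - m) <= m`! * B ^ m)%N.
Proof.
move=> B_gt0 lqB.
have [d [g [h [nz_minor bordered0]]]] := exists_maximal_minor (jacobian lq).
have dm := minor_neq0_leq nz_minor.
apply: (@leq_trans (2 ^ size (enum [predC h]))).
  rewrite leq_exp2l // -cardE leq_subLR -[leqLHS]card_ord -(cardC (mem h)).
  by rewrite leq_add2r (leq_trans (card_size h)) ?size_tuple.
apply: (@leq_trans (sparsity (minor (jacobian lq) g h))).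
  apply: (@sparsity_vanishing _ _ (fun=> -1)) (enum_uniq _) nz_minor _ => x.
  rewrite mem_enum oppr_eq0 oner_eq0 => xh; split=> //.
  exact: specialize_minor_jacobian_eq0.
apply: leq_trans (sparsity_det (B := B) _) _ => [i j|].
  by rewrite !mxE; apply: leq_trans (sparsity_mderiv _ _) (lqB _).
by rewrite leq_mul ?leq_pexp2l // leq_fact.
Qed.

End Composition.

End ProductLowerBound.

Section Permanent.
Local Open Scope ring_scope.
Variable R : comPzSemiRingType.

Definition permanent n (A : 'M[R]_n) : R := \sum_(s : 'S_n) \prod_i A i (s i).

Lemma permanent_mx00 (A : 'M[R]_0) : permanent A = 1.
Proof.
rewrite /permanent; under eq_bigr do rewrite big_ord0.
by rewrite sumr_const card_Sn.
Qed.

Lemma lift_perm_bij n (i : 'I_n.+1) :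
  bijective (fun u : 'I_n.+1 * 'S_n => lift_perm i u.1 u.2).
Proof.
apply: inj_card_bij => [[j s] [l t] /= /permP eq_lift|]; last first.
  by rewrite card_prod !card_Sn card_ord factS.
have := eq_lift i; rewrite !lift_perm_id => jl; rewrite -{l}jl in eq_lift *.
congr (_, _); apply/permP => a; apply: (@lift_inj _ j).
by rewrite -!(lift_perm_lift i) eq_lift.
Qed.

Lemma expand_permanent_row n (A : 'M[R]_n.+1) i :
  permanent A = \sum_j A i j * permanent (row' i (col' j A)).
Proof.
rewrite /permanent (reindex _ (onW_bij _ (lift_perm_bij i))) /=.
under [RHS]eq_bigr => j _ do rewrite mulr_sumr.
rewrite pair_bigA; apply: eq_bigr => -[j s] _ /=.
rewrite (bigD1_ord i) //= lift_perm_id; congr (_ * _).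
by apply: eq_bigr => l _; rewrite lift_perm_lift !mxE.
Qed.

(* Entry (i, j) is 1 for j <= i and y_i for j = i + 1. *)
Definition hessenberg n (y : 'I_n -> R) : 'M[R]_n.+1 :=
  \matrix_(i, j)
    if unlift ord0 j is Some l
    then if (l < i)%N then 1 else if l == i :> nat then y l else 0
    else 1.

Lemma row'_col'_hessenberg n (y : 'I_n.+1 -> R) (j : 'I_n.+2) : (j <= 1)%N ->
  row' ord0 (col' j (hessenberg y)) = hessenberg (y \o lift ord0).
Proof.
move=> j1; apply/matrixP => i l; rewrite !mxE.
case: (unliftP ord0 l) => [k|] ->.
  have -> : lift j (lift ord0 k) = lift ord0 (lift ord0 k).
    by apply: val_inj; case: j j1 => [[|[|]]].
  by rewrite liftK !lift0 ltnS eqSS.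
case: unliftP => // k /(congr1 val) kE.
suff k0 : k = 0%N :> nat by rewrite k0 lift0.
by case: j j1 kE => [[|[|]]] //= _ _ [].
Qed.

(* The first row has at most two nonzero entries, in columns that agree below
   it, so both terms of the expansion have the same minor. *)
Lemma permanent_hessenberg n (y : 'I_n -> R) :
  permanent (hessenberg y) = \prod_i (1 + y i).
Proof.
elim: n y => [|n IH] y; rewrite (expand_permanent_row _ ord0) !big_ord_recl /=.
  by rewrite !big_ord0 mxE unlift_none permanent_mx00 mul1r addr0.
rewrite big1 => [|j _]; last by rewrite mxE liftK mul0r.
rewrite addr0 !row'_col'_hessenberg // !IH -mulrDl.
by rewrite !mxE unlift_none liftK.
Qed.

End Permanent.

Section PermanentComposition.
Local Open Scope ring_scope.

Lemma PER_comp_mxvec n k (A : 'M[{mpoly int[k]}]_n) :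
  PER n \mPo [tuple mxvec A 0 e | e < n * n] = permanent A.
Proof.
rewrite rmorph_sum; apply: eq_bigr => s _; rewrite rmorph_prod.
apply: eq_bigr => i _ /=.
by rewrite comp_mpolyXU -tnth_nth tnth_mktuple mxvecE.
Qed.

Lemma sparsity_hessenbergX n (R : comNzRingType) i j :
  (sparsity (hessenberg (fun l : 'I_n => 'X_l : {mpoly R[n]}) i j) <= 1)%N.
Proof.
rewrite mxE; case: unlift => [l|]; last by rewrite sparsity1.
by do 2?case: ifP => _; rewrite ?sparsity1 ?sparsityX ?sparsity0.
Qed.

Lemma PER_comp_sparsity_bound n m (p : {mpoly int[m]})
    (lq : m.-tuple {mpoly int[n.+1 * n.+1]}) B :
    PER n.+1 = p \mPo lq -> (0 < B)%N ->
    (forall j, sparsity (tnth lq j) <= B)%N ->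
  (2 ^ (n - m) <= m`! * B ^ m)%N.
Proof.
move=> PERE B_gt0 lqB.
pose H := hessenberg (fun l : 'I_n => 'X_l : {mpoly int[n]}).
pose lr := [tuple mxvec H 0 e | e < n.+1 * n.+1].
apply: (prod_1DX_comp_sparsity_bound (p := p)
          (lq := [tuple tnth lq j \mPo lr | j < m])) B_gt0 _.
  by rewrite -comp_mpolyA -PERE PER_comp_mxvec permanent_hessenberg.
move=> j; rewrite tnth_mktuple; apply: leq_trans (lqB j).
apply: sparsity_comp_mpoly => e; rewrite tnth_mktuple.
by case/mxvec_indexP: e => i l; rewrite mxvecE sparsity_hessenbergX.
Qed.

End PermanentComposition.

Lemma linear_lt_exp2 a b : exists u, a + u * b < 2 ^ u.
Proof.
set v := a + 2 * b; exists (2 * v).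
have lt_v : v < 2 ^ v by exact: ltn_expl.
rewrite [X in 2 ^ X]mulnC expnM; apply: (@leq_trans (v.+1 ^ 2)); last first.
  by rewrite leq_exp2r.
by rewrite -mulnn /v; nia.
Qed.

Lemma horner_norm_le (R : numDomainType) (p : {poly R}) (x : R) :
  (1 <= `|x| -> `|p.[x]| <= (\sum_(i < size p) `|p`_i|) * `|x| ^+ size p)%R.
Proof.
move=> x1; rewrite horner_coef mulr_suml.
apply: le_trans (ler_norm_sum _ _ _) (ler_sum _ _) => i _.
by rewrite normrM normrX ler_wpM2l // ler_weXn2l // ltnW.
Qed.

Lemma horner_lt_exp2 (R : archiNumDomainType) (p : {poly R}) :
  exists2 n : nat, 0 < n & (`|p.[n%:R]| < (2 ^ n)%:R)%R.
Proof.
pose C := Num.bound (\sum_(i < size p) `|p`_i|)%R.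
have [u lt_u] := linear_lt_exp2 C (size p).
exists (2 ^ u); first by rewrite expn_gt0.
apply: (@le_lt_trans _ _ (C * (2 ^ u) ^ size p)%:R%R).
  apply: le_trans (horner_norm_le _ _) _; rewrite normr_nat.
    by rewrite ler1n expn_gt0.
  rewrite natrM [in leRHS]natrX ler_wpM2r ?exprn_ge0 // ltW //.
  by rewrite archi_boundP // sumr_ge0.
rewrite ltr_nat -expnM; apply: (@leq_ltn_trans (2 ^ C * 2 ^ (u * size p))).
  by rewrite leq_mul // ltnW // ltn_expl.
by rewrite -expnD ltn_exp2l.
Qed.

Theorem theorem3 (k m : nat) (hk : 0 < k) (hm : 0 < m) :
  ~ mSPS k m PER.
Proof.
case=> Q hQ.
pose growth := (((m`! * 2 ^ m.+1)%:R : int) *: Q ^+ m)%R.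
have [[//|n] _ lt_growth] := horner_lt_exp2 growth.
have [f [alpha [_ PERE bitsizeQ fQ]]] := hQ n.+1 isT.
have := bitsizeQ (Ordinal hk) (Ordinal hm).
case QE: Q.[Posz n.+1]%R => [B|//]; rewrite lez_nat => /(leq_trans (ltn0Sn _)).
move=> B_gt0.
have PER_comp : PER n.+1 =
    ((\sum_i \prod_j 'X_j ^+ alpha i j) \mPo [tuple f j | j < m])%R.
  rewrite sum_prodX_comp_mpoly PERE; apply: eq_bigr => i _.
  by apply: eq_bigr => j _; rewrite tnth_mktuple.
have lower : 2 ^ (n - m) <= m`! * B ^ m.
  apply: (PER_comp_sparsity_bound PER_comp B_gt0) => j; rewrite tnth_mktuple.
  by have [_] := fQ j; rewrite QE.
have upper : m`! * 2 ^ m.+1 * B ^ m < 2 ^ n.+1.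
  move: lt_growth; rewrite hornerZ horner_exp (natz n.+1) QE -(natz B).
  by rewrite -natrX -natrM normr_nat ltr_nat.
suff: m`! * B ^ m < 2 ^ (n - m) by rewrite ltnNge lower.
rewrite -(ltn_pmul2r (expn_gt0 2 m.+1)) mulnAC -expnD.
by apply: leq_trans upper _; rewrite leq_exp2l //; lia.
Qed.
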